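(* Let $G(I,P;E)$ be a pinned graph. The following are equivalent: (i) There exists an isostatic realization of $G$ (i.e. some placement of the vertices in $\mathbb{R}^2$ for which the pinned framework is isostatic). (ii) $G$ satisfies the Pinned Framework Conditions. (iii) For every placement $\mathbf{P}$ of the pinned vertices $P$ in $\mathbb{R}^2$ that uses at least two distinct locations, and every generic position of the inner vertices $I$, the resulting pinned framework is isostatic.
   Context: A pinned graph $G(I,P;E)$ consists of a finite set $I$ of inner vertices, a finite set $P$ of pinned vertices (disjoint from $I$), and a finite set $E$ of edges, each edge joining two distinct vertices of $I\cup P$ and having at least one endpoint in $I$. A subgraph $G'(I',P';E')$ is given by a nonempty subset $E'\subseteq E$, with $I'$ (resp. $P'$) the set of inner (resp. pinned) vertices incident to edges of $E'$. $G$ satisfies the Pinned Framework Conditions if $|E|=2|I|$ and for every subgraph $G'(I',P';E')$: $|E'|\le 2|I'|$ if $|P'|\ge 2$; $|E'|\le 2|I'|-1$ if $|P'|=1$; $|E'|\le 2|I'|-3$ if $P'=\emptyset$. A pinned framework is a pinned graph together with positions $\mathbf{p}_v\in\mathbb{R}^2$ for all vertices, where the positions of the pins are prescribed constants and the two endpoints of each edge are at distinct points. Its rigidity matrix has one row per edge $(i,j)\in E$ and two columns per inner vertex; the row of $(i,j)$ contains $\mathbf{p}_i-\mathbf{p}_j$ in the columns of $i$ and $\mathbf{p}_j-\mathbf{p}_i$ in the columns of $j$ (entries for pinned endpoints are omitted, as pin columns are removed) and zeros elsewhere. The pinned framework is rigid if this matrix has rank $2|I|$, independent if its rows are linearly independent,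 and isostatic if it is both rigid and independent. The inner vertices are in generic position if every minor of this matrix that is not identically zero as a polynomial in the coordinates of the inner vertices (pin coordinates being fixed constants) is nonzero at the given positions.
   Formalization: In (iii), ''at least two distinct locations'' is required not of P as a whole but of the pins P' of every subgraph with |P'| ≥ 2 and |E'| = 2|I'|; read literally, (iii) fails when an inner vertex of degree 2 has coincident pins, and is vacuous when |P| ≤ 1. *)

(* Defs.v *)
From mathcomp Require Import all_boot all_order all_algebra.
From mathcomp Require Import mpoly reals.

Set Implicit Arguments.
Unset Strict Implicit.
Unset Printing Implicit Defensive.

Import GRing.Theory.
Local Open Scope ring_scope.

(* Vertices are the elements of [I + P]: [inl i] is inner, [inr p] is pinned.
   An edge is the (unordered) set of its two endpoints. *)
Record pinned_graph (I P : finType) := PinnedGraph {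
  edges : {set {set I + P}};
  edge_card2 : forall e, e \in edges -> #|e| = 2%N;
  edge_inner : forall e, e \in edges -> exists i : I, inl i \in e }.

Section Combinatorics.
Variables I P : finType.
Implicit Type F : {set {set I + P}}.

Definition inner_of F : {set I} := [set i | inl i \in cover F].
Definition pins_of F : {set P} := [set p | inr p \in cover F].

Definition subgraph (G : pinned_graph I P) F : Prop :=
  F \subset edges G /\ F != set0.

(* The bounds 2|I'| - 1 and 2|I'| - 3 are written without subtraction. *)
Definition pinned_framework_conditions (G : pinned_graph I P) : Prop :=
  (#|edges G| = 2 * #|I|)%N /\
  forall F, subgraph G F ->
    [/\ (2 <= #|pins_of F| -> #|F| <= 2 * #|inner_of F|)%N,
        (#|pins_of F| = 1 -> #|F| + 1 <= 2 * #|inner_of F|)%N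
      & (#|pins_of F| = 0 -> #|F| + 3 <= 2 * #|inner_of F|)%N].

End Combinatorics.

Section Frameworks.
Variables I P : finType.

(* The matrix is defined over any commutative ring, so that it can be taken
   both at real positions and at indeterminate inner positions. *)
Section Matrix.
Variable A : comNzRingType.

Definition place (inner : I -> 'rV[A]_2) (pin : P -> 'rV[A]_2) (v : I + P) :
  'rV[A]_2 := match v with inl i => inner i | inr p => pin p end.

(* The sum in the entry of edge [e] and inner vertex [i \in e] has exactly one
   term: [w] is the other endpoint of [e]. *)
Definition rigidity_mx (G : pinned_graph I P) (pos : I + P -> 'rV[A]_2) :
  'M[A]_(#|edges G|, #|{: I * 'I_2}|) :=
  \matrix_(r < #|edges G|, c < #|{: I * 'I_2}|)
    let e : {set I + P} := enum_val r in
    let: (i, k) := enum_val c : I * 'I_2 in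
    if inl i \in e
    then \sum_(w in e :\ inl i) (pos (inl i) ord0 k - pos w ord0 k)
    else 0.

End Matrix.

Variable R : realType.
Variable G : pinned_graph I P.

Definition is_framework (pos : I + P -> 'rV[R]_2) : Prop :=
  forall u v, [set u; v] \in edges G -> pos u <> pos v.

Definition rigid (pos : I + P -> 'rV[R]_2) : Prop :=
  \rank (rigidity_mx G pos) = (2 * #|I|)%N.

Definition independent (pos : I + P -> 'rV[R]_2) : Prop :=
  row_free (rigidity_mx G pos).

Definition isostatic_framework (pos : I + P -> 'rV[R]_2) : Prop :=
  [/\ is_framework pos, rigid pos & independent pos].

(* Inner vertices at indeterminate coordinates, pins at the constants [pin]. *)
Definition symbolic_place (pin : P -> 'rV[R]_2) :
  I + P -> 'rV[{mpoly R[#|{: I * 'I_2}|]}]_2 :=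
  place (fun i => \row_k 'X_(enum_rank (i, k)))
        (fun p => map_mx (@mpolyC #|{: I * 'I_2}| R) (pin p)).

(* [f] and [g] select the rows and columns of a minor; a non-injective
   selection gives the zero polynomial and imposes no condition. *)
Definition generic_inner (pin : P -> 'rV[R]_2) (inner : I -> 'rV[R]_2) : Prop :=
  forall (n : nat) (f : 'I_n -> 'I_#|edges G|)
         (g : 'I_n -> 'I_#|{: I * 'I_2}|),
    \det (mxsub f g (rigidity_mx G (symbolic_place pin))) != 0 ->
    \det (mxsub f g (rigidity_mx G (place inner pin))) != 0.

Definition two_locations (Q : {set P}) (pin : P -> 'rV[R]_2) : Prop :=
  exists p q, [/\ p \in Q, q \in Q & pin p <> pin q].

(* "At least two distinct locations" has to hold locally: it is required of
   every subgraph that meets the bound |E'| <= 2|I'| for |P'| >= 2 with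
   equality.  Asking it of the set of all pins only would not do: an inner
   vertex of degree 2 joined to two coincident pins has dependent rows, wherever
   the remaining pins are; and with fewer than two pins no placement at all would
   have two locations. *)
Definition enough_locations (pin : P -> 'rV[R]_2) : Prop :=
  forall F : {set {set I + P}}, subgraph G F ->
    (2 <= #|pins_of F|)%N -> (#|F| = 2 * #|inner_of F|)%N ->
    two_locations (pins_of F) pin.

End Frameworks.

(* Main.v *)
(* Necessity: with |P'| = 0, 1, >= 2 a subgraph has a 3-, 1- or 0-dimensional
   space of trivial infinitesimal motions of its inner vertices, and independent
   rows cannot outnumber the remaining dimensions.

   Sufficiency: instead of positions, prescribe a normal n_e for each edge e
   (Whiteley's parallel drawings).  The conditions n_e . (p_u - p_v) = 0 form a
   square inhomogeneous linear system in the inner positions.  If it has a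
   solution p with p_u <> p_v for every edge, then p_u - p_v is a nonzero
   multiple of n_e turned by a quarter, so the rigidity matrix at p is, up to
   row scaling, the matrix of the system, which is nonsingular.  An edge e is
   not collapsed when the homogenized system with e doubled, carrying two
   independent directions, is nonsingular as well.  By a generic form of Rado's
   theorem all these systems are nonsingular for one choice of normals as soon
   as every nonempty edge set F spans more than |F| dimensions, and that is what
   the counts give.  A generic position then inherits the nonzero determinant. *)
Require Import Defs.
From mathcomp Require Import all_boot all_order all_algebra.
From mathcomp Require Import mpoly reals zify.

Set Implicit Arguments.
Unset Strict Implicit.
Unset Printing Implicit Defensive.

Import GRing.Theory Num.Theory.
Local Open Scope ring_scope.

(** * Generic vectors in families of subspaces *)

Lemma nat_avoid (C : finType) (bad : C -> nat -> bool) :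
  (forall c a b, bad c a -> bad c b -> a = b) ->
  exists a, forall c, ~~ bad c a.
Proof.
move=> bad_inj; pose M := #|C|.
case: (boolP [exists a : 'I_M.+1, [forall c, ~~ bad c a]]) => [/existsP[a]|].
  by move/forallP=> ok; exists a.
rewrite negb_exists => /forallP all_bad.
have /fin_all_exists[f fP] (a : 'I_M.+1) : exists c, bad c a.
  by have := all_bad a; rewrite negb_forall => /existsP[c]; rewrite negbK; exists c.
(* Each condition excludes at most one number, so the [#|C| + 1] candidates would need distinct
   conditions. *)
have f_inj : injective f.
  by move=> a b eq_f; apply/val_inj/(bad_inj (f a)); rewrite ?fP // eq_f fP.
by have := leq_card f f_inj; rewrite card_ord ltnn.
Qed.

Section GenericVectors.
Variable K : numFieldType.

(** Any two of these vectors form a basis of the plane, so a proper subspace contains at most one of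
    them. *)
Definition line_pt (a : nat) : 'rV[K]_2 := \row_k (if k == 0 then 1 else a%:R).

Lemma line_pt_mul D (A : 'M[K]_(2, D)) a :
  line_pt a *m A = row 0 A + a%:R *: row 1 A.
Proof.
apply/rowP => c; rewrite !mxE big_ord_recl big_ord1 !mxE /= mul1r.
by congr (_ + _ * A _ c); apply/val_inj.
Qed.

Lemma line_pt_sub_inj D m (A : 'M[K]_(2, D)) (B : 'M_(m, D)) a b :
  ~~ (A <= B)%MS ->
  (line_pt a *m A <= B)%MS -> (line_pt b *m A <= B)%MS -> a = b.
Proof.
move=> nAB; rewrite !line_pt_mul => sa sb; apply/eqP.
apply: contraNT nAB => neq_ab.
have ab0 : (a%:R - b%:R : K) != 0 by rewrite subr_eq0 eqr_nat.
have s1 : (row 1 A <= B)%MS.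
  rewrite -(eqmx_scale _ ab0) scalerBl.
  rewrite -(addrKA (row 0 A)) ![_ *: _ + row 0 A]addrC.
  by rewrite addmx_sub ?eqmx_opp.
have s0 : (row 0 A <= B)%MS.
  by rewrite -[row 0 A](addrK (a%:R *: row 1 A)) addmx_sub // eqmx_opp scalemx_sub.
apply/row_subP => k; case: (unliftP 0 k) => [j|] -> //.
by rewrite (_ : lift 0 j = 1) //; apply/val_inj; rewrite /= (ord1 j).
Qed.

(* Rado's theorem for generic vectors, simultaneously for a family [S] of
   systems of subspaces parametrized by the same two coordinates. *)
Lemma generic_vectors D (S T : finType) (A : S -> T -> 'M[K]_(2, D)) :
  (forall s (F : {set T}), #|F| <= \rank (\sum_(t in F) <<A s t>>)%MS)%N ->
  exists n : T -> 'rV[K]_2, forall s,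
    row_free (\matrix_(j < #|T|) (n (enum_val j) *m A s (enum_val j))).
Proof.
move=> rado.
(* Hybrid system: the subspaces indexed by [Z] are already cut down to one vector each. Rado's
   condition is kept while [Z] grows by one index at a time. *)
pose B (n : T -> 'rV[K]_2) (Z : {set T}) s t : 'M_D :=
  if t \in Z then <<n t *m A s t>>%MS else <<A s t>>%MS.
have step k : (k <= #|T|)%N -> exists Z : {set T}, #|Z| = k /\
  exists n, forall s (F : {set T}), (#|F| <= \rank (\sum_(t in F) B n Z s t)%MS)%N.
  elim: k => [_|k IHk lt_k].
    exists set0; rewrite cards0; split=> //; exists (fun=> 0) => s F.
    apply: leq_trans (rado s F) _; rewrite leq_eqVlt; apply/orP; left.
    by apply/eqP; congr (\rank _); apply: eq_bigr => t _; rewrite /B in_set0.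
  have [Z [cardZ [n nP]]] := IHk (ltnW lt_k).
  have /existsP[t tZ] : [exists t, t \notin Z].
    apply: contraLR lt_k; rewrite negb_exists => /forallP allZ.
    rewrite -leqNgt -cardZ -cardsT subset_leq_card //.
    by apply/subsetP => u _; have := allZ u; rewrite negbK.
  (* A value [a] is bad if the vector chosen for [t] falls into the span of the other members of [F]
     although the whole space of [t] does not. *)
  pose W s (F : {set T}) := (\sum_(u in F :\ t) B n Z s u)%MS.
  pose bad (c : S * {set T}) a :=
    ~~ (A c.1 t <= W c.1 c.2)%MS && (line_pt a *m A c.1 t <= W c.1 c.2)%MS.
  have [|a aP] := @nat_avoid _ bad.
    by move=> c a b /andP[nA sa] /andP[_ sb]; exact: line_pt_sub_inj nA sa sb.
  exists (t |: Z); split; first by rewrite cardsU1 tZ cardZ.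
  pose n' u := if u == t then line_pt a else n u.
  exists n' => s F.
  have BE u : u != t -> B n' (t |: Z) s u = B n Z s u.
    by move=> ut; rewrite /B in_setU1 (negPf ut) /n' (negPf ut).
  have sumE : (\sum_(u in F :\ t) B n' (t |: Z) s u)%MS = W s F.
    by apply: eq_bigr => u; rewrite !inE => /andP[/BE].
  have [tF|tF] := boolP (t \in F); last first.
    apply: leq_trans (nP s F) _; rewrite leq_eqVlt; apply/orP; left; apply/eqP.
    congr (\rank _); apply: eq_bigr => u uF; rewrite BE //.
    by apply: contraNneq tF => <-.
  have Bt : B n' (t |: Z) s t = <<line_pt a *m A s t>>%MS.
    by rewrite /B setU11 /n' eqxx.
  have split_t n0 Z0 :
    (\sum_(u in F) B n0 Z0 s u = B n0 Z0 s t + \sum_(u in F :\ t) B n0 Z0 s u)%MS.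
    rewrite (bigD1 t) //=; congr addsmx; apply: eq_bigl => u.
    by rewrite !inE andbC.
  rewrite split_t Bt sumE; have := aP (s, F); rewrite negb_and negbK /=.
  (* If the space of [t] lies in the span of the others, shrinking it costs no rank. Otherwise the
     chosen vector adds one to the bound for [F :\ t]. *)
  case/orP => [sA|nsA].
    apply: leq_trans (nP s F) _; rewrite split_t mxrankS //.
    rewrite addsmx_sub -/(W s F) addsmxSr andbT.
    by apply: submx_trans (addsmxSr _ _); rewrite /B (negPf tZ) genmxE.
  rewrite (cardsD1 t) tF add1n.
  apply: leq_ltn_trans (nP s (F :\ t)) _.
  rewrite -/(W s F); apply: rank_ltmx; rewrite /ltmx addsmxSr /= addsmx_sub.
  by rewrite genmxE (negPf nsA).
have [Z [cardZ [n nP]]] := step _ (leqnn _).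
have ZT t : t \in Z.
  suff -> : Z = setT by rewrite inE.
  by apply/eqP; rewrite eqEcard subsetT cardsT cardZ leqnn.
exists n => s; rewrite -row_leq_rank; apply: leq_trans (mxrankS _).
  by have := nP s setT; rewrite cardsT; apply.
apply/sumsmx_subP => t _; rewrite /B ZT genmxE.
by apply: submx_trans (row_sub (enum_rank t) _); rewrite rowK enum_rankK.
Qed.
End GenericVectors.

Lemma rank_adds_le (K : fieldType) m1 m2 n (U : 'M[K]_(m1, n)) (V : 'M_(m2, n)) :
  (\rank (U + V)%MS <= \rank U + \rank V)%N.
Proof. exact: mxrank_adds_leqif. Qed.

Lemma rank_sum_le (K : fieldType) (T : finType) m n (A : T -> 'M[K]_(m, n))
    (S : {set T}) :
  (\rank (\sum_(t in S) <<A t>>)%MS <= m * #|S|)%N.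
Proof.
rewrite mulnC -sum_nat_const.
elim/big_rec2: _ => [|t d U _ le_dU]; first by rewrite mxrank0.
apply: leq_trans (rank_adds_le _ _) _.
by rewrite leq_add // mxrank_gen rank_leq_row.
Qed.

(** * Spaces spanned by vertices and edges *)

Section EdgeSpaces.
Variables (K : fieldType) (I P : finType).
Local Notation N := #|{: I * 'I_2}|.

(** Multiplying a row [x] by this block writes [x] into the two columns of the vertex; pins have no
    columns. *)
Definition vertex_cols (v : I + P) : 'M[K]_(2, N) :=
  match v with
  | inl i => \matrix_(k, c) (enum_val c == (i, k))%:R
  | inr _ => 0
  end.

(* The last coordinate homogenizes the system: a solution is a column with last
   entry 1, and [hom_cols v] maps it to the position of the vertex [v] up to a
   quarter turn, which is the prescribed [q a] at a pin [a]. *)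
Variable q : P -> 'cV[K]_2.
Implicit Type S : {set I}.

Definition hom_cols (v : I + P) : 'M[K]_(2, N + 1) :=
  row_mx (vertex_cols v) (match v with inl _ => 0 | inr a => q a end).

Definition pin_row : 'rV[K]_(N + 1) := row_mx 0 1%:M.

Lemma hom_cols_pin a : hom_cols (inr a) = q a *m pin_row.
Proof. by rewrite /hom_cols /pin_row mul_mx_row mulmx0 mulmx1. Qed.

Definition inner_space (S : {set I}) : 'M[K]_(N + 1) :=
  (\sum_(i in S) <<hom_cols (inl i)>>)%MS.

Lemma rank_inner_space_ub S : (\rank (inner_space S) <= 2 * #|S|)%N.
Proof. exact: rank_sum_le. Qed.

Lemma inner_space_full S :
  row_full (inner_space S + (inner_space (~: S) + pin_row))%MS.
Proof.
set W := (_ + _)%MS.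
have sW i : (hom_cols (inl i) <= W)%MS.
  have [iS|iS] := boolP (i \in S).
    apply: submx_trans (addsmxSl _ _).
    by rewrite (sumsmx_sup i) // genmxE.
  apply: submx_trans (addsmxSr _ _); apply: submx_trans (addsmxSl _ _).
  by rewrite (sumsmx_sup i) ?inE // genmxE.
have sP : (pin_row <= W)%MS.
  by apply: submx_trans (addsmxSr _ _); apply: addsmxSr.
rewrite -sub1mx; apply/row_subP => c; rewrite rowE mulmx1.
case: (split_ordP c) => [j|j] ->.
  rewrite -[j]enum_valK; case: (enum_val j) => i k.
  apply: submx_trans (sW i); apply: submx_trans (row_sub k _).
  rewrite (_ : row k _ = delta_mx 0 (lshift 1 (enum_rank (i, k)))) //.
  apply/rowP => d; rewrite !mxE eqxx /=; case: (split_ordP d) => [d'|d'] ->.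
    rewrite !mxE (inj_eq (@lshift_inj _ _)) -(inj_eq enum_val_inj) enum_rankK.
    by [].
  by rewrite !mxE eq_rlshift.
apply: submx_trans sP.
rewrite (_ : pin_row = delta_mx 0 (rshift N j)) //.
apply/rowP => d; rewrite !mxE eqxx /=; case: (split_ordP d) => [d'|d'] ->.
  by rewrite !mxE eq_lrshift.
by rewrite !mxE !ord1 !eqxx.
Qed.

Lemma card_coords : N = (2 * #|I|)%N.
Proof. by rewrite card_prod card_ord mulnC. Qed.

Lemma rank_pin_row : \rank pin_row = 1%N.
Proof. by rewrite rank_row_0mx mxrank1. Qed.

Lemma rank_inner_space_pin S : (2 * #|S| + 1 <= \rank (inner_space S + pin_row)%MS)%N.
Proof.
have := inner_space_full S; rewrite -col_leq_rank addsmxC -addsmxA.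
rewrite [(pin_row + _)%MS]addsmxC => leN.
have := leq_trans leN (rank_adds_le _ _).
have := rank_inner_space_ub (~: S); have := cardsC S; have := card_coords; lia.
Qed.

Lemma rank_inner_space_lb S : (2 * #|S| <= \rank (inner_space S))%N.
Proof.
have := rank_inner_space_pin S; have := rank_adds_le (inner_space S) pin_row.
rewrite rank_pin_row; lia.
Qed.

(** The two spaces have ranks at most [2 * #|S| + 1] and [2 * #|~: S| + 1] and together fill
    [2 * #|I| + 1] dimensions. *)
Lemma rank_inner_space_cap S :
  (\rank ((inner_space S + pin_row) :&: (inner_space (~: S) + pin_row))%MS <= 1)%N.
Proof.
have := mxrank_sum_cap (inner_space S + pin_row)%MS (inner_space (~: S) + pin_row)%MS.
have : (N + 1 <= \rank (inner_space S + pin_row + (inner_space (~: S) + pin_row))%MS)%N.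
  rewrite col_leq_rank -sub1mx; apply: submx_trans (addsmxS (addsmxSl _ _) (submx_refl _)).
  by rewrite sub1mx inner_space_full.
have := rank_adds_le (inner_space S) pin_row.
have := rank_adds_le (inner_space (~: S)) pin_row.
have := rank_inner_space_ub S; have := rank_inner_space_ub (~: S).
have := cardsC S; have := card_coords; rewrite rank_pin_row; lia.
Qed.

Variables (m : nat) (src : 'I_m -> I) (tgt : 'I_m -> I + P).
Implicit Type F : {set 'I_m}.

Definition inner_ends F : {set I} :=
  [set i | [exists r in F, (i == src r) || (inl i == tgt r)]].
Definition pin_ends F : {set P} := [set a | [exists r in F, inr a == tgt r]].

Definition edge_cols r := vertex_cols (inl (src r)) - vertex_cols (tgt r).
Definition edge_mx r := hom_cols (inl (src r)) - hom_cols (tgt r).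
Definition edge_space F : 'M[K]_(N + 1) := (\sum_(r in F) <<edge_mx r>>)%MS.

Lemma edge_mx_sub F r : r \in F -> (edge_mx r <= edge_space F)%MS.
Proof. by move=> rF; rewrite (sumsmx_sup r) // genmxE. Qed.

Lemma edge_space_inner F (S : {set I}) :
  inner_ends F \subset S -> (edge_space F <= inner_space S + pin_row)%MS.
Proof.
move/subsetP=> sFS; apply/sumsmx_subP => r rF; rewrite genmxE.
have sS i : i \in inner_ends F -> (hom_cols (inl i) <= inner_space S + pin_row)%MS.
  move=> /sFS iS; apply: submx_trans (addsmxSl _ _).
  by rewrite (sumsmx_sup i) // genmxE.
rewrite addmx_sub ?eqmx_opp //.
  by apply: sS; rewrite inE; apply/existsP; exists r; rewrite rF eqxx.
case E: (tgt r) => [j|a].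
  by apply: sS; rewrite inE; apply/existsP; exists r; rewrite rF E eqxx orbT.
by rewrite hom_cols_pin (submx_trans (submxMl _ _)) // addsmxSr.
Qed.

(* Vertex-disjoint parts share at most the homogenizing coordinate. *)
Lemma edge_space_rank_split F (C : {set I}) :
  (forall r j, r \in F -> tgt r = inl j -> (src r \in C) = (j \in C)) ->
  (\rank (edge_space [set r in F | src r \in C]) +
     \rank (edge_space (F :\: [set r in F | src r \in C]))
     <= \rank (edge_space F) + 1)%N.
Proof.
move=> closedC; set F1 := [set r in F | _]; rewrite -mxrank_sum_cap leq_add //.
  rewrite mxrankS // addsmx_sub; apply/andP; split; apply/sumsmx_subP => r;
  by rewrite !inE genmxE => /andP[? ?]; rewrite edge_mx_sub.
apply: leq_trans (rank_inner_space_cap C); rewrite mxrankS // capmxS //.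
  apply: edge_space_inner; apply/subsetP => i; rewrite !inE => /existsP[r].
  rewrite !inE -andbA => /and3P[rF srcC /orP[/eqP-> //|/eqP E]].
  by rewrite -(closedC r).
apply: edge_space_inner; apply/subsetP => i; rewrite !inE => /existsP[r].
rewrite !inE -andbA => /and3P[]; rewrite negb_and => /orP[/negPf-> //|srcC] rF.
by case/orP=> [/eqP-> //|/eqP E]; rewrite -(closedC r).
Qed.

Hypothesis count0 : forall F, F != set0 -> pin_ends F = set0 ->
  (#|F| + 3 <= 2 * #|inner_ends F|)%N.
Hypothesis count1 : forall F, F != set0 ->
  {in pin_ends F &, forall a b, q a = q b} ->
  (#|F| + 1 <= 2 * #|inner_ends F|)%N.
Hypothesis count2 : forall F, F != set0 -> (#|F| <= 2 * #|inner_ends F|)%N.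

(** Modulo the edge space [U] all vertices met by [F] coincide with [v], so [U] misses little of the
    space of the inner ends. How little depends on the number of pin locations. *)
Lemma edge_space_rank_conn F v : F != set0 ->
  (forall r, r \in F -> (hom_cols (inl (src r)) - hom_cols (inl v) <= edge_space F)%MS) ->
  (#|F| < \rank (edge_space F))%N.
Proof.
move=> F0 conn; set U := edge_space F in conn *; set S := inner_ends F.
have connS i : i \in S -> (hom_cols (inl i) - hom_cols (inl v) <= U)%MS.
  rewrite inE => /existsP[r /andP[rF /orP[/eqP->|/eqP E]]]; first exact: conn.
  have -> : hom_cols (inl i) - hom_cols (inl v)
      = hom_cols (inl (src r)) - hom_cols (inl v) - edge_mx r.
    by rewrite /edge_mx -E [RHS]addrC opprB subrKA.
  by rewrite addmx_sub ?conn // eqmx_opp edge_mx_sub.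
have connP a : a \in pin_ends F -> (hom_cols (inr a) - hom_cols (inl v) <= U)%MS.
  rewrite inE => /existsP[r /andP[rF /eqP E]].
  have -> : hom_cols (inr a) - hom_cols (inl v)
      = hom_cols (inl (src r)) - hom_cols (inl v) - edge_mx r.
    by rewrite /edge_mx -E [RHS]addrC opprB subrKA.
  by rewrite addmx_sub ?conn // eqmx_opp edge_mx_sub.
have spanS m1 (W : 'M_(m1, N + 1)) : (U <= W)%MS -> (hom_cols (inl v) <= W)%MS ->
    (inner_space S <= W)%MS.
  move=> sUW svW; apply/sumsmx_subP => i iS; rewrite genmxE.
  rewrite -[hom_cols (inl i)](subrK (hom_cols (inl v))) addmx_sub //.
  exact: submx_trans (connS i iS) sUW.
(* Without pins, the two rows of [v] complete [U], so its rank falls short of [2 * #|S|] by at most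
   2. *)
have [P0|[a aP]] := set_0Vmem (pin_ends F).
  have := count0 F0 P0; rewrite -/S.
  have := mxrankS (spanS _ _ (addsmxSl U (hom_cols (inl v))) (addsmxSr _ _)).
  have := rank_inner_space_lb S; have := rank_adds_le U (hom_cols (inl v)).
  have := rank_leq_row (hom_cols (inl v)); lia.
have svP m1 (W : 'M_(m1, N + 1)) : (U <= W)%MS -> (pin_row <= W)%MS -> (hom_cols (inl v) <= W)%MS.
  move=> sUW spW; rewrite -[hom_cols (inl v)](subKr (hom_cols (inr a))) addmx_sub //.
    by rewrite hom_cols_pin (submx_trans (submxMl _ _)).
  by rewrite eqmx_opp (submx_trans (connP _ aP)).
have rankUp : (2 * #|S| + 1 <= \rank (U + pin_row)%MS)%N.
  apply: leq_trans (rank_inner_space_pin S) _; rewrite mxrankS // addsmx_sub addsmxSr andbT.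
  by apply: spanS; rewrite ?svP ?addsmxSl ?addsmxSr.
(* A pin expresses [v] through [U] and [pin_row]. With a single location this gives [U] rank at
   least [2 * #|S|]. *)
have [/forall_inP same|] := boolP
    [forall (a | a \in pin_ends F), [forall (b | b \in pin_ends F), q a == q b]].
  have := count1 F0 (fun a b aP bP => eqP (forall_inP (same a aP) b bP)).
  have := rank_adds_le U pin_row; rewrite -/S rank_pin_row; lia.
rewrite negb_forall_in => /existsP[b /andP[bP]].
rewrite negb_forall_in => /existsP[c /andP[cP neq_bc]].
(* Two different locations put a nonzero multiple of [pin_row] into [U], which raises the bound to
   [2 * #|S| + 1]. *)
have spU : (pin_row <= U)%MS.
  have : ((q b - q c) *m pin_row <= U)%MS.
    rewrite mulmxBl -!hom_cols_pin -(subrKA (hom_cols (inl v))) addmx_sub ?connP //.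
    by rewrite -opprB eqmx_opp connP.
  move: neq_bc; rewrite -subr_eq0; set d := q b - q c => d0.
  have /existsP[k dk] : [exists k, d k 0 != 0].
    apply: contraNT d0; rewrite negb_exists => /forallP dk0.
    by apply/eqP/colP => k; rewrite [RHS]mxE; apply/eqP; have := dk0 k; rewrite negbK.
  move/(submx_trans _); apply; apply: submx_trans (row_sub k _).
  rewrite row_mul [row k d]mx11_scalar mul_scalar_mx mxE.
  by rewrite eqmx_scale.
have sUpU : (U + pin_row <= U)%MS by rewrite addsmx_sub submx_refl.
have := mxrankS sUpU; have := count2 F0; rewrite -/S; lia.
Qed.

(** Strong induction on the number of edges: two parts have a surplus of one dimension each, and
    splitting loses at most one, so one survives. *)
Lemma edge_space_rank F : F != set0 -> (#|F| < \rank (edge_space F))%N.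
Proof.
have [k] := ubnP #|F|; elim: k F => // k IHk F; rewrite ltnS => leFk F0.
have /set0Pn[r0 r0F] := F0.
(* Congruence modulo the edge space takes the place of graph connectivity; [C] is the class of the
   source of [r0]. *)
pose C := [set i | (hom_cols (inl i) - hom_cols (inl (src r0)) <= edge_space F)%MS].
have closedC r j : r \in F -> tgt r = inl j -> (src r \in C) = (j \in C).
  move=> rF E; rewrite !inE -(subrKA (hom_cols (inl j))).
  have sr : (hom_cols (inl (src r)) - hom_cols (inl j) <= edge_space F)%MS.
    by rewrite -E edge_mx_sub.
  apply/idP/idP => s; last exact: addmx_sub.
  by rewrite -(addKr (hom_cols (inl (src r)) - hom_cols (inl j)) (_ - _)) addmx_sub ?eqmx_opp.
have := edge_space_rank_split closedC; set F1 := [set r in F | _] => /= split_rank.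
have sF1 : F1 \subset F by apply/subsetP => r; rewrite inE => /andP[].
have [F2_0|F2_n0] := eqVneq (F :\: F1) set0.
  apply: (@edge_space_rank_conn F (src r0)) => // r rF.
  have : r \in F1 by move/eqP: F2_0; rewrite setD_eq0 => /subsetP->.
  by rewrite !inE => /andP[].
have r0F1 : r0 \in F1 by rewrite !inE r0F subrr sub0mx.
have F1_n0 : F1 != set0 by apply/set0Pn; exists r0.
have cardF := cardsID F1 F; rewrite (setIidPr sF1) in cardF.
have F1_gt0 : (0 < #|F1|)%N by rewrite card_gt0.
have F2_gt0 : (0 < #|F :\: F1|)%N by rewrite card_gt0.
have ih1 := IHk F1 _ F1_n0; have ih2 := IHk (F :\: F1) _ F2_n0.
have {}ih1 := ih1 ltac:(lia); have {}ih2 := ih2 ltac:(lia).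
rewrite -(ltn_add2r 1); apply: leq_trans split_rank.
by rewrite -cardF addn1 -addnS -addSn leq_add.
Qed.

End EdgeSpaces.

(** * Generic edge normals *)

Section GenericDirections.
Variables (K : numFieldType) (I P : finType) (q : P -> 'cV[K]_2).
Local Notation N := #|{: I * 'I_2}|.
Variables (m : nat) (src : 'I_m -> I) (tgt : 'I_m -> I + P).
Hypothesis card_edges : m = (2 * #|I|)%N.
Hypothesis edge_space_gt : forall F : {set 'I_m},
  F != set0 -> (#|F| < \rank (edge_space q src tgt F))%N.
Local Notation edge_mx := (edge_mx q src tgt).

(* System [Some e] doubles the edge [e]; system [None] adds the homogenizing
   coordinate and so tests the edges alone. *)
Definition edge_system (s t : option 'I_m) : 'M[K]_(2, N + 1) :=
  match t, s with
  | Some r, _ | None, Some r => edge_mx r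
  | None, None => (const_mx 1 : 'cV_2) *m pin_row K I
  end.

Lemma edge_mx_neq0 r : edge_mx r != 0.
Proof.
have F0 : [set r] != set0 by apply/set0Pn; exists r; rewrite inE.
apply: contraTneq (edge_space_gt F0) => E.
rewrite -leqNgt cards1 (@leq_trans 0) // leqn0 mxrank_eq0 -submx0.
by apply/sumsmx_subP => t /set1P->; rewrite genmxE E sub0mx.
Qed.

(** The member [None] adds one element to a set of edges, and the strict inequality [edge_space_gt]
    leaves room for it. When it stands alone, being nonzero suffices. *)
Lemma edge_system_rado s (F : {set option 'I_m}) :
  (#|F| <= \rank (\sum_(t in F) <<edge_system s t>>)%MS)%N.
Proof.
have subA t : t \in F ->
    (edge_system s t <= \sum_(t in F) <<edge_system s t>>)%MS.
  by move=> tF; rewrite (sumsmx_sup t) // genmxE.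
pose F0 := [set r | Some r \in F].
have cardF : #|F| = ((None \in F) + #|F0|)%N.
  rewrite (cardsD1 None) -(card_imset F0 Some_inj); congr (_ + #|pred_of_set _|)%N.
  apply/setP => -[r|]; rewrite !inE ?mem_imset ?inE //; last by apply/esym/imsetP => -[].
  exact: Some_inj.
have [F00|F00] := eqVneq F0 set0; last first.
  have subF0 : (edge_space q src tgt F0 <= \sum_(t in F) <<edge_system s t>>)%MS.
    by apply/sumsmx_subP => r; rewrite inE genmxE => /subA.
  apply: leq_trans (mxrankS subF0); apply: leq_trans (edge_space_gt F00).
  by rewrite cardF -add1n leq_add2r leq_b1.
rewrite cardF F00 cards0 addn0; have [NF|//] := boolP (None \in F).
apply: leq_trans (mxrankS (subA _ NF)); rewrite lt0n mxrank_eq0.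
case: s {subA} => [r|] /=; first exact: edge_mx_neq0.
apply/eqP => /matrixP /(_ 0 (rshift _ 0)).
by rewrite !mxE big_ord1 !mxE mul1r (unsplitK (inr _)) !mxE eqxx => /eqP; rewrite oner_eq0.
Qed.

Lemma generic_directions :
  exists n : 'I_m -> 'rV[K]_2, exists z : 'cV[K]_(N + 1),
    [/\ row_full (\matrix_(r < m)
          (n r *m edge_cols K src tgt r)),
        pin_row K I *m z = 1%:M,
        forall r, n r *m edge_mx r *m z = 0
      & forall r, edge_mx r *m z != 0].
Proof.
have [n nP] := generic_vectors edge_system_rado.
pose Q s := \matrix_(j < #|{: option 'I_m}|)
  (n (enum_val j) *m edge_system s (enum_val j)).
have QE s j M (z : 'M_(_, M)) :
    row j (Q s *m z) = n (enum_val j) *m edge_system s (enum_val j) *m z.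
  by rewrite row_mul rowK.
have fullQ s : row_full (Q s).
  rewrite /row_full (eqP (nP s)) card_option card_ord card_edges.
  by rewrite -card_coords addn1.
(* Zero on the edges and one on the extra row, which keeps the homogenizing coordinate of the
   solution from vanishing. *)
pose b : 'cV[K]_#|{: option 'I_m}| := \col_j (enum_val j == None)%:R.
pose z' := pinvmx (Q None) *m b.
have Qz' : Q None *m z' = b by rewrite mulmxA mulmxVp ?mul1mx ?nP.
have nz' t : n t *m edge_system None t *m z' = ((t == None)%:R)%:M.
  rewrite -[t]enum_rankK -QE Qz' enum_rankK; apply/rowP => j.
  by rewrite !mxE enum_rankK ord1 eqxx.
have pz' : pin_row K I *m z' != 0.
  apply/eqP => pz'0.
  have := nz' None; rewrite /= -!mulmxA pz'0 !mulmx0 => /matrixP/(_ 0 0).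
  by rewrite !mxE !eqxx /= ?mulr1n => /esym/eqP; rewrite oner_eq0.
pose t := (pin_row K I *m z') 0 0.
have t0 : t != 0.
  apply: contraNneq pz' => t0.
  by rewrite [_ *m _]mx11_scalar -/t t0 raddf0.
exists (n \o Some), (t^-1 *: z'); split=> [||r|r].
(* Dropping the homogenizing column kills the row of [None], so the edge rows alone span all inner
   coordinates. *)
- rewrite -sub1mx.
  have /submxP[Y EY] : (row_mx (1%:M : 'M[K]_N) (0 : 'M_(N, 1)) <= Q None)%MS.
    exact: submx_full.
  have -> : 1%:M = Y *m lsubmx (Q None).
    by rewrite mulmx_lsub -EY row_mxKl.
  apply: submx_trans (submxMl _ _) _; apply/row_subP => j.
  have -> : row j (lsubmx (Q None)) = lsubmx (row j (Q None)).
    by apply/rowP => c; rewrite !mxE.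
  rewrite rowK.
  case E : (enum_val j) => [r|].
    rewrite (_ : lsubmx _ = n (Some r) *m edge_cols K src tgt r).
      rewrite -[X in (X <= _)%MS](@rowK _ _ _
        (fun r => (n \o Some) r *m edge_cols K src tgt r)).
      exact: row_sub.
    by rewrite -mulmx_lsub /= linearB /= !row_mxKl.
  rewrite mulmxA (_ : lsubmx _ = 0) ?sub0mx //.
  by rewrite -mulmx_lsub row_mxKl mulmx0.
- rewrite -scalemxAr [_ *m z']mx11_scalar -/t scale_scalar_mx.
  by rewrite mulVf.
- by rewrite -scalemxAr (nz' (Some r)) scale_scalar_mx mulr0 raddf0.
(* If the edge [r] collapsed, [z'] would also satisfy the second equation on [r], and the
   nonsingular system [Some r] would force it to be zero. *)
rewrite -scalemxAr; apply/eqP => /eqP; rewrite scaler_eq0 invr_eq0 (negPf t0) /=.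
move/eqP => ez'; have : Q (Some r) *m z' = 0.
  apply/row_matrixP => j; rewrite QE row0.
  case E : (enum_val j) => [r'|]; last by rewrite -mulmxA ez' mulmx0.
  by rewrite (nz' (Some r')) raddf0.
rewrite -[RHS](mulmx0 _ (Q (Some r))) => /(row_full_inj (fullQ _)) z'0.
by move: pz'; rewrite z'0 mulmx0 eqxx.
Qed.
End GenericDirections.

(** * From edge normals to positions *)

Lemma edge_endpoints (I P : finType) (G : pinned_graph I P) :
  exists ends : 'I_#|edges G| -> I * (I + P), forall r,
    enum_val r = [set inl (ends r).1; (ends r).2] /\ inl (ends r).1 != (ends r).2.
Proof.
apply: (@fin_all_exists _ _ (fun r (e : I * (I + P)) =>
  enum_val r = [set inl e.1; e.2] /\ inl e.1 != e.2)) => r.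
have rG := enum_valP r; have [i iE] := edge_inner rG.
have := edge_card2 rG; rewrite (cardsD1 (inl i)) iE => -[/eqP/cards1P[w Ew]].
exists (i, w); split=> /=; first by rewrite -(setD1K iE) Ew.
have : w \in enum_val r :\ inl i by rewrite Ew set11.
by rewrite !inE eq_sym => /andP[].
Qed.

Section Rigidity.
Variables (R : realType) (I P : finType) (G : pinned_graph I P).
Local Notation N := #|{: I * 'I_2}|.
Local Notation m := #|edges G|.
Variables (src : 'I_m -> I) (tgt : 'I_m -> I + P).
Hypothesis endsE : forall r, enum_val r = [set inl (src r); tgt r].
Hypothesis ends_neq : forall r, inl (src r) != tgt r.

Lemma row_rigidity_mx (pos : I + P -> 'rV[R]_2) r :
  row r (rigidity_mx G pos) =
    (pos (inl (src r)) - pos (tgt r)) *m edge_cols R src tgt r.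
Proof.
apply/rowP => c; rewrite -[c]enum_valK; case: (enum_val c) => i k.
have entry (v : I + P) (x : 'rV[R]_2) :
    (x *m vertex_cols R v) 0 (enum_rank (i, k)) = x 0 k *+ (v == inl i).
  rewrite mxE; case: v => [j|a] /=; last first.
    by rewrite big1 // => l _; rewrite mxE mulr0.
  rewrite (bigD1 k) //= big1 => [|l lk]; rewrite mxE enum_rankK.
    by rewrite addr0 xpair_eqE eqxx andbT mulr_natr eq_sym.
  by rewrite xpair_eqE (eq_sym k) (negPf lk) andbF mulr0.
rewrite mulmxBr [RHS]mxE [X in _ = _ + X]mxE !entry !mxE enum_rankK endsE /= !inE.
rewrite ![inl i == _]eq_sym; move: (ends_neq r).
move: (inl (src r)) (tgt r) => u w uw.
have [ui|ui] := eqVneq u (inl i).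
  have wi : w == inl i = false by rewrite eq_sym -ui (negPf uw).
  by rewrite -ui setU1K ?inE // big_set1 ui wi mulr1n mulr0n subr0.
have [wi|wi] := eqVneq w (inl i); last by rewrite !mulr0n subr0.
by rewrite -wi setUC setU1K ?inE 1?eq_sym // big_set1 mulr0n sub0r mulr1n opprB.
Qed.

Lemma mem_cover_edges (F : {set 'I_m}) v :
  (v \in cover (enum_val @: F)) = [exists r in F, (v == inl (src r)) || (v == tgt r)].
Proof.
apply/bigcupP/exists_inP => [[e /imsetP[r rF ->]]|[r rF vr]].
  by rewrite endsE !inE => vr; exists r.
by exists (enum_val r); rewrite ?imset_f // endsE !inE.
Qed.

Lemma inner_of_edges (F : {set 'I_m}) :
  inner_of (enum_val @: F) = inner_ends src tgt F.
Proof. by apply/setP => i; rewrite !inE mem_cover_edges. Qed.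

Lemma pins_of_edges (F : {set 'I_m}) :
  pins_of (enum_val @: F) = pin_ends tgt F.
Proof. by apply/setP => a; rewrite !inE mem_cover_edges. Qed.

Lemma subgraph_edges (F : {set 'I_m}) : F != set0 -> subgraph G (enum_val @: F).
Proof.
move=> /set0Pn[r rF]; split; last by apply/set0Pn; exists (enum_val r); apply: imset_f.
by apply/subsetP => e /imsetP[s _ ->]; apply: enum_valP.
Qed.

Lemma card_edges_imset (F : {set 'I_m}) : #|enum_val @: F| = #|F|.
Proof. exact/card_imset/enum_val_inj. Qed.

Definition quarter : 'M[R]_2 := \matrix_(i, j) ((i < j)%:R - (j < i)%:R).

Lemma quarter_tr : quarter^T = - quarter.
Proof. by apply/matrixP => i j; rewrite !mxE opprB. Qed.

Lemma quarter_sqr : quarter *m quarter = - 1%:M.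
Proof.
apply/matrixP => i j; rewrite !mxE big_ord_recl big_ord1 !mxE.
case: (unliftP 0 i) => [i'|] ->; case: (unliftP 0 j) => [j'|] ->;
  rewrite ?ord1 /= /bump /= ?subr0 ?sub0r ?subrr ?mul0r ?mulr0 ?mulr1 ?mul1r
    ?addr0 ?add0r ?oppr0 //.
Qed.

Lemma quarter_isotropic (x : 'rV[R]_2) : x *m quarter *m x^T = 0.
Proof.
set c := _ *m _; have : c^T = - c.
  by rewrite !trmx_mul trmxK quarter_tr mulNmx mulmxN mulmxA.
move/matrixP/(_ 0 0); rewrite !mxE => /eqP; rewrite -addr_eq0 -mulr2n mulrn_eq0 /= => /eqP c0.
by apply/matrixP => i j; rewrite !ord1 [RHS]mxE -c0 mxE.
Qed.

(** The rows annihilating a nonzero [x] form a line, and the turned [x] is a nonzero vector on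
    it. *)
Lemma quarter_span (n : 'rV[R]_2) (x : 'cV[R]_2) :
  n *m x = 0 -> x != 0 -> (n <= x^T *m quarter)%MS.
Proof.
move=> nx x0.
have sub_ker : (x^T *m quarter <= kermx x)%MS.
  by apply/sub_kermxP; have := quarter_isotropic x^T; rewrite trmxK.
have free_quarter : row_free quarter.
  by apply/row_freeP; exists (- quarter); rewrite mulmxN quarter_sqr opprK.
have rank_x : \rank x = 1%N by rewrite -mxrank_tr rank_rV trmx_eq0 x0.
have [_] := mxrank_leqif_sup sub_ker.
rewrite mxrankMfree // mxrank_ker mxrank_tr rank_x eqxx => /esym ker_sub.
by apply: submx_trans ker_sub; apply/sub_kermxP.
Qed.

Lemma exists_inner (pin : P -> 'rV[R]_2) :
  pinned_framework_conditions G -> enough_locations G pin ->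
  exists inner, row_full (rigidity_mx G (place inner pin)).
Proof.
(* The sign makes a second quarter turn carry the transpose of [q a] back to [pin a]. *)
move=> [cardE counts] locs; pose q a := (- (pin a *m quarter))^T.
have cnt (F : {set 'I_m}) (F0 : F != set0) := counts _ (subgraph_edges F0).
have count0 (F : {set 'I_m}) : F != set0 -> pin_ends tgt F = set0 ->
    (#|F| + 3 <= 2 * #|inner_ends src tgt F|)%N.
  move=> /cnt[_ _]; rewrite pins_of_edges inner_of_edges card_edges_imset => + P0.
  by rewrite P0 cards0; apply.
have count2 (F : {set 'I_m}) : F != set0 ->
    (#|F| <= 2 * #|inner_ends src tgt F|)%N.
  move=> /cnt[]; rewrite pins_of_edges inner_of_edges card_edges_imset.
  by case: #|pin_ends tgt F| => [|[|k]] c2 c1 c0;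
    [move: (c0 erefl) | move: (c1 erefl) | exact: c2]; lia.
have count1 (F : {set 'I_m}) : F != set0 ->
    {in pin_ends tgt F &, forall a b, q a = q b} ->
    (#|F| + 1 <= 2 * #|inner_ends src tgt F|)%N.
  move=> F0 same; have [] := cnt F F0.
  rewrite pins_of_edges inner_of_edges card_edges_imset => _ c1 c0.
  have [le1|gt1] := leqP #|pin_ends tgt F| 1.
    by case: #|pin_ends tgt F| le1 c1 c0 => [|[|k]] // _ c1 c0;
      [move: (c0 erefl) | move: (c1 erefl)]; lia.
  (* Several pins at one location: equality in the bound would contradict [locs]. *)
  rewrite addn1 ltn_neqAle count2 // andbT; apply/eqP => tight.
  have [] := locs _ (subgraph_edges F0); rewrite ?pins_of_edges ?inner_of_edges ?card_edges_imset //.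
  move=> a [b [aP bP]]; apply; have /trmx_inj/oppr_inj := same a b aP bP.
  move/(congr1 (mulmx^~ quarter)); rewrite -!mulmxA quarter_sqr !mulmxN !mulmx1.
  exact: oppr_inj.
have gt F := edge_space_rank count0 count1 count2 (F := F).
have [n [z [full_n z1 nz0 ez0]]] := generic_directions cardE gt.
pose inner i := (hom_cols q (inl i) *m z)^T *m quarter.
have innerE v : place inner pin v = (hom_cols q v *m z)^T *m quarter.
  case: v => [i|a] //=; rewrite hom_cols_pin -mulmxA z1 mulmx1 /q trmxK.
  by rewrite mulNmx -mulmxA quarter_sqr mulmxN opprK mulmx1.
exists inner; rewrite -sub1mx; apply: submx_trans (_ : _ <= _)%MS.
  by rewrite sub1mx; exact: full_n.
(* The normal is a multiple of the edge vector, so its row in the system is a multiple of the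
   rigidity row. *)
apply/row_subP => r; rewrite rowK; apply: submx_trans (row_sub r _).
rewrite row_rigidity_mx !innerE -mulmxBl -linearB -mulmxBl submxMr //.
by apply: quarter_span; rewrite ?mulmxA ?nz0 ?ez0.
Qed.
End Rigidity.

(** * Nonvanishing of polynomials and generic positions *)

Lemma mpoly_nonroot (K : numFieldType) n (p : {mpoly K[n]}) :
  p != 0 -> exists v : 'I_n -> K, p.@[v] != 0.
Proof.
elim: n p => [|n IHn] p p0.
  exists (fun=> 0); apply: contraNneq p0 => E.
  by rewrite [p]nvar0_mpolyC mevalC in E *; rewrite E.
have /hasP[m0 m0p _] : has predT (msupp p) by rewrite has_predT lt0n size_eq0 msupp_eq0.
pose wd (i : 'I_n) := widen_ord (leqnSn n) i.
pose trunc (m : 'X_{1..n.+1}) := [multinom m (wd i) | i < n].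
(* The coefficient of a power of the last variable that occurs in [p]. Truncation is injective on
   monomials with this last exponent, so nothing cancels. *)
pose q : {mpoly K[n]} := \sum_(m <- msupp p | m ord_max == m0 ord_max) p@_m *: 'X_[trunc m].
have q0 : q != 0.
  apply: contraTneq (m0p) => q0; rewrite mcoeff_msupp negbK.
  have := congr1 (mcoeff (trunc m0)) q0; rewrite mcoeff0 raddf_sum /= => <-.
  rewrite -big_filter (bigD1_seq m0) ?mem_filter ?eqxx ?m0p ?filter_uniq ?msupp_uniq //=.
  rewrite mcoeffZ mcoeffX eqxx mulr1 big1_seq ?addr0 // => m /andP[neq_m].
  rewrite mem_filter => /andP[/eqP max_m _]; rewrite mcoeffZ mcoeffX.
  case: eqP => [eq_m|]; last by rewrite mulr0.
  case/eqP: neq_m; apply/mnmP => i; have [lt_in|le_ni] := ltnP i n.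
    have -> : i = wd (Ordinal lt_in) by apply/val_inj.
    by have := congr1 (fun m' : 'X_{1..n} => m' (Ordinal lt_in)) eq_m; rewrite !mnmE.
  suff -> : i = ord_max by [].
  by apply/val_inj/eqP; rewrite eqn_leq /= -ltnS ltn_ord.
have [v qv] := IHn q q0.
(* [p] with its first variables fixed at [v]; its coefficient at the last exponent of [m0] is the
   nonzero value of [q]. *)
pose P : {poly K} :=
  \sum_(m <- msupp p) (p@_m * \prod_i v i ^+ m (wd i)) *: 'X^(m ord_max).
have P0 : P != 0.
  apply: contraNneq qv => P0; have := congr1 (fun Q : {poly K} => Q`_(m0 ord_max)) P0.
  rewrite coef0 coef_sum => <-; rewrite raddf_sum /= big_mkcond /=.
  apply/eqP/eq_bigr => m _; rewrite coefZ coefXn eq_sym.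
  case: eqP => _; rewrite ?mulr0 // mulr1 mevalZ mevalX; congr (_ * _).
  by apply: eq_bigr => i _; rewrite mnmE.
have [t Pt] : exists t, ~~ root P t.
  (* [size P] exceeds the degree by one, so this many distinct points cannot all be roots. *)
  have [allP|/allPn[t _ nt]] := boolP (all (root P) [seq a%:R | a <- iota 0 (size P)]).
    have := max_poly_roots P0 allP; rewrite size_map size_iota ltnn.
    by case/(_ _)/notF; rewrite map_inj_uniq ?iota_uniq // => a b /eqP; rewrite eqr_nat => /eqP.
  by exists t.
(* The last index is out of range for [insub] and receives the default [t]. *)
exists (fun i => oapp v t (insub (i : nat))).
move: Pt; rewrite /root /P horner_sum mevalE; congr (_ != 0).
apply: eq_bigr => m _; rewrite hornerZ hornerXn -mulrA big_ord_recr /=.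
rewrite insubF ?ltnn //=; congr (_ * (_ * _)).
by apply: eq_bigr => i _; rewrite valK.
Qed.

Section Genericity.
Variables (R : realType) (I P : finType) (G : pinned_graph I P).
Local Notation N := #|{: I * 'I_2}|.
Local Notation m := #|edges G|.
Variable pin : P -> 'rV[R]_2.

Definition coords (inner : I -> 'rV[R]_2) (c : 'I_N) : R :=
  inner (enum_val c).1 0 (enum_val c).2.

Lemma map_symbolic_rigidity_mx inner :
  map_mx (meval (coords inner)) (rigidity_mx G (symbolic_place pin)) =
    rigidity_mx G (place inner pin).
Proof.
apply/matrixP => r c; rewrite !mxE /=; case: (enum_val c) => i k.
case: ifP => _; last exact: raddf0.
rewrite raddf_sum /=; apply: eq_bigr => w _; rewrite mevalB.
have coordsE j : (coords inner) (enum_rank (j, k)) = inner j 0 k.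
  by rewrite /coords enum_rankK.
congr (_ - _); first by rewrite !mxE mevalXU coordsE.
by case: w => [j|a]; rewrite !mxE ?mevalXU ?coordsE ?mevalC.
Qed.

Lemma det_symbolic_rigidity_mx inner n (f : 'I_n -> 'I_m) (g : 'I_n -> 'I_N) :
  (\det (mxsub f g (rigidity_mx G (symbolic_place pin)))).@[coords inner] =
    \det (mxsub f g (rigidity_mx G (place inner pin))).
Proof. by rewrite -det_map_mx map_mxsub map_symbolic_rigidity_mx. Qed.

(** A position is generic once the product of all nonzero symbolic minors does not vanish there. *)
Lemma exists_generic_inner : exists inner, generic_inner G pin inner.
Proof.
pose M n (f : 'I_n -> 'I_m) (g : 'I_n -> 'I_N) :=
  \det (mxsub f g (rigidity_mx G (symbolic_place pin))).
pose p : {mpoly R[N]} :=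
  \prod_(n < m.+1) \prod_(f : {ffun 'I_n -> 'I_m})
    \prod_(g : {ffun 'I_n -> 'I_N} | M n f g != 0) M n f g.
have p0 : p != 0.
  by apply/prodf_neq0 => n _; apply/prodf_neq0 => f _; apply/prodf_neq0.
have [v pv] := mpoly_nonroot p0.
pose inner i : 'rV_2 := \row_k v (enum_rank (i, k)).
have : p.@[coords inner] != 0.
  rewrite (@meval_eq _ _ _ v) // => c.
  by rewrite /coords mxE -surjective_pairing enum_valK.
rewrite rmorph_prod => /prodf_neq0 {}pv.
exists inner => n f g Mfg.
(* A repeated row kills the minor, so a nonzero minor has at most [m] rows and occurs in the finite
   product. *)
have f_inj : injective f.
  move=> i j eq_f; apply: contraNeq Mfg => neq_ij.
  by apply/eqP/(determinant_alternate neq_ij) => c; rewrite !mxE eq_f.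
have le_nm : (n < m.+1)%N by have := leq_card f f_inj; rewrite !card_ord ltnS.
have := pv (Ordinal le_nm) isT; rewrite rmorph_prod => /prodf_neq0/(_ (finfun f) isT).
rewrite rmorph_prod => /prodf_neq0/(_ (finfun g)) /=.
have EM : M n (finfun f) (finfun g) = M n f g.
  by congr (\det _); apply/matrixP => i j; rewrite !mxE !ffunE.
by rewrite EM det_symbolic_rigidity_mx; apply.
Qed.

(* The square minor witnessing [row_full] at [inner0] is a nonzero polynomial. *)
Lemma generic_row_free inner0 inner : m = N ->
  row_full (rigidity_mx G (place inner0 pin)) ->
  generic_inner G pin inner -> row_free (rigidity_mx G (place inner pin)).
Proof.
move=> cardE full0 gen; set A := rigidity_mx G _; set A0 := rigidity_mx G _ in full0.
have detA0 : \det (colsub (cast_ord cardE) A0) != 0.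
  have /row_fullP[B BA] := full0.
  have : rowsub (cast_ord cardE) B *m colsub (cast_ord cardE) A0 = 1%:M.
    rewrite mul_rowsub_mx mulmx_colsub BA.
    by apply/matrixP => i j; rewrite !mxE (inj_eq (@cast_ord_inj _ _ _)).
  by case/mulmx1_unit => _; rewrite unitmxE unitfE.
have := gen _ id (cast_ord cardE); rewrite -/A => /(_ _).
have -> : mxsub id (cast_ord cardE) A = A *m colsub (cast_ord cardE) 1%:M.
  by rewrite mulmx_colsub mulmx1.
rewrite -unitfE -unitmxE => unitA; rewrite -row_leq_rank.
rewrite -{1}(mxrank_unit (unitA _)) ?mxrankM_maxl //.
apply: contraNneq detA0 => sym0.
by rewrite -/A0 -det_symbolic_rigidity_mx sym0 meval0.
Qed.
End Genericity.

(** * Necessity of the counts *)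

Section Necessity.
Variables (R : realType) (I P : finType) (G : pinned_graph I P).
Local Notation N := #|{: I * 'I_2}|.
Local Notation m := #|edges G|.
Variables (src : 'I_m -> I) (tgt : 'I_m -> I + P).
Hypothesis endsE : forall r, enum_val r = [set inl (src r); tgt r].
Hypothesis ends_neq : forall r, inl (src r) != tgt r.

Lemma independent_framework (pos : I + P -> 'rV[R]_2) :
  independent G pos -> is_framework G pos.
Proof.
move=> free u v uvG eq_uv.
pose r := enum_rank_in uvG [set u; v].
have Er : [set u; v] = [set inl (src r); tgt r] by rewrite -endsE enum_rankK_in.
have pos_r w : w \in [set u; v] -> pos w = pos u by rewrite !inE => /orP[/eqP->|/eqP->].
have : row r (rigidity_mx G pos) = 0.
  rewrite (row_rigidity_mx endsE ends_neq) !pos_r ?Er ?inE ?eqxx ?orbT //.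
  by rewrite subrr mul0mx.
rewrite rowE -[RHS](mul0mx _ (rigidity_mx G pos)) => /(row_free_inj free).
by move/matrixP/(_ 0 r); rewrite !mxE !eqxx => /eqP; rewrite oner_eq0.
Qed.

(* Each column of [x] is an infinitesimal motion of the subgraph [F]. *)
Lemma motions_bound (pos : I + P -> 'rV[R]_2) (F : {set 'I_m}) k
    (x : I + P -> 'M[R]_(2, k)) :
  independent G pos ->
  {in pin_ends tgt F, forall a, x (inr a) = 0} ->
  {in F, forall r, (pos (inl (src r)) - pos (tgt r)) *m
                     (x (inl (src r)) - x (tgt r)) = 0} ->
  (forall c : 'cV_k,
     {in inner_ends src tgt F, forall i, x (inl i) *m c = 0} -> c = 0) ->
  (#|F| + k <= 2 * #|inner_ends src tgt F|)%N.
Proof.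
move=> free x_pin x_edge x_free; set S := inner_ends src tgt F.
pose sel : 'I_#|F| -> 'I_m := enum_val.
pose W := rowsub sel (rigidity_mx G pos).
have rankW : \rank W = #|F|.
  apply/eqP; rewrite /W -[rigidity_mx G pos]mul1mx -mul_rowsub_mx.
  rewrite mxrankMfree //; apply/row_freeP; exists (colsub sel 1%:M).
  rewrite mulmx_colsub mulmx1; apply/matrixP => i j; rewrite !mxE.
  by rewrite (inj_eq enum_val_inj).
pose U := (\sum_(i in S) <<vertex_cols R (inl i : I + P)>>)%MS.
have rankU : (\rank U <= 2 * #|S|)%N by exact: rank_sum_le.
have subU i : i \in S -> (vertex_cols R (inl i : I + P) <= U)%MS.
  by move=> iS; rewrite (sumsmx_sup i) // genmxE.
have rowW j : row j W = (pos (inl (src (sel j))) - pos (tgt (sel j))) *m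
    edge_cols R src tgt (sel j).
  by rewrite -(row_rigidity_mx endsE ends_neq) row_rowsub.
have selF j : sel j \in F by apply: enum_valP.
have src_S r : r \in F -> src r \in S.
  by move=> rF; rewrite inE; apply/exists_inP; exists r; rewrite ?eqxx.
have tgt_S r i : r \in F -> tgt r = inl i -> i \in S.
  by move=> rF E; rewrite inE; apply/exists_inP; exists r; rewrite ?E ?eqxx ?orbT.
have tgt_P r a : r \in F -> tgt r = inr a -> a \in pin_ends tgt F.
  by move=> rF E; rewrite inE; apply/exists_inP; exists r; rewrite ?E ?eqxx.
have sWU : (W <= row_base U)%MS.
  rewrite eq_row_base; apply/row_subP => j; rewrite rowW.
  rewrite (submx_trans (submxMl _ _)) // addmx_sub ?subU ?src_S // eqmx_opp.
  case E: (tgt (sel j)) => [i|a]; last exact: sub0mx.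
  exact/subU/(tgt_S (sel j)).
pose Z : 'M[R]_(N, k) := \matrix_(c, l) x (inl (enum_val c).1) (enum_val c).2 l.
have colsZ i : vertex_cols R (inl i : I + P) *m Z = x (inl i).
  apply/matrixP => l d; rewrite mxE (bigD1 (enum_rank (i, l))) //= big1 => [|c cil].
    by rewrite !mxE enum_rankK eqxx mul1r addr0.
  by rewrite mxE (can2_eq enum_valK enum_rankK) (negPf cil) mul0r.
have WZ : W *m Z = 0.
  apply/row_matrixP => j; rewrite row_mul rowW row0 -mulmxA.
  rewrite [edge_cols R src tgt (sel j) *m Z]mulmxBl colsZ.
  rewrite -[RHS](x_edge (sel j)) //; congr (_ *m (_ - _)).
  case E: (tgt (sel j)) => [i|a]; first by rewrite colsZ.
  by rewrite mul0mx x_pin // (tgt_P (sel j)).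
(* The rows of [F] factor as [Y *m B] through at most [2 * #|S|] dimensions. Since [Y] kills
   [B *m Z], their ranks, at least [#|F|] and [k], add up to at most that number. *)
have /submxP[Y EY] := sWU; set B := row_base U in EY sWU.
have YBZ : Y *m (B *m Z) = 0 by rewrite mulmxA -EY.
have rankY : (#|F| <= \rank Y)%N
  by have := mxrankM_maxl Y B; rewrite -EY rankW.
have rankBZ : (k <= \rank (B *m Z))%N.
  rewrite -mxrank_tr row_leq_rank -kermx_eq0; apply/eqP/row_matrixP => j.
  rewrite row0; set c := row j _; rewrite -[c]trmxK.
  suff -> : c^T = 0 by rewrite trmx0.
  have : c *m (B *m Z)^T = 0 by rewrite -row_mul mulmx_ker row0.
  move/(congr1 trmx); rewrite trmx_mul trmxK trmx0 => BZc.
  apply: x_free => i iS.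
  have /submxP[D ED] : (vertex_cols R (inl i : I + P) <= B)%MS.
    by rewrite eq_row_base subU.
  have -> : x (inl i) = D *m (B *m Z).
    by rewrite -colsZ ED; apply/esym/mulmxA.
  by rewrite -mulmxA BZc mulmx0.
apply: leq_trans rankU; apply: leq_trans (mulmx0_rank_max YBZ).
exact: leq_add.
Qed.

Lemma isostatic_counts (pos : I + P -> 'rV[R]_2) :
  isostatic_framework G pos -> pinned_framework_conditions G.
Proof.
move=> [frame rig free]; split; first by rewrite -rig (eqP free).
move=> F0 [sF0 F0n]; pose F := [set r | enum_val r \in F0] : {set 'I_m}.
have EF : F0 = enum_val @: F.
  apply/setP => e; apply/idP/imsetP => [eF|[r]]; last by rewrite inE => ? ->.
  have eG := subsetP sF0 e eF.
  by exists (enum_rank_in eG e); rewrite ?inE enum_rankK_in.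
rewrite EF (inner_of_edges endsE) (pins_of_edges endsE) card_edges_imset.
have pos_neq r : pos (inl (src r)) - pos (tgt r) != 0.
  by rewrite subr_eq0; apply/eqP/frame; rewrite -endsE enum_valP.
have quarter0 (d : 'rV[R]_2) : d != 0 -> quarter R *m d^T != 0.
  apply: contra_neq => E; apply: trmx_inj.
  by rewrite trmx0 -[d^T]opprK -[d^T]mul1mx -mulNmx -quarter_sqr -mulmxA E mulmx0 oppr0.
have src_S r : r \in F -> src r \in inner_ends src tgt F.
  by move=> rF; rewrite inE; apply/exists_inP; exists r; rewrite ?eqxx.
split=> [_|/eqP/cards1P[a Ea]|/eqP].
- rewrite -[#|F|]addn0.
  apply: (@motions_bound pos F 0 (fun=> 0)) => // [r rF|c _].
    by rewrite subrr mulmx0.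
  exact: flatmx0.
(* One pin: the rotation about it. *)
- apply: (@motions_bound pos F 1 (fun v => quarter R *m (pos v - pos (inr a))^T)) => //.
  + by move=> b; rewrite Ea => /set1P->; rewrite subrr trmx0 mulmx0.
  + move=> r rF; rewrite -mulmxBr -linearB /= opprB addrA subrK mulmxA.
    exact: quarter_isotropic.
  (* An edge at the pin has its source elsewhere, and the rotation does not vanish there. *)
  + move=> c xc0; have : a \in pin_ends tgt F by rewrite Ea set11.
    rewrite inE => /exists_inP[r rF /eqP Er].
    have := xc0 _ (src_S r rF); rewrite Er [c]mx11_scalar mul_mx_scalar => /eqP.
    rewrite scaler_eq0 (negPf (quarter0 _ (pos_neq r))) orbF => /eqP->.
    by rewrite raddf0.
rewrite cards_eq0 => /eqP P0; have /set0Pn[r rF] : F != set0.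
  by apply: contra_neq F0n => F_0; rewrite EF F_0 imset0.
(* No pins: two translations and the rotation about the origin. *)
apply: (@motions_bound pos F (2 + 1) (fun v => row_mx 1%:M (quarter R *m (pos v)^T))) => //.
- by move=> b; rewrite P0 inE.
- move=> s sF; rewrite opp_row_mx add_row_mx subrr -mulmxBr -linearB /=.
  by rewrite mul_mx_row mulmx0 mulmxA quarter_isotropic row_mx0.
move=> c; rewrite -[c]vsubmxK; set t := usubmx c; set s := dsubmx c => xc0.
have xs i : i \in inner_ends src tgt F -> t + quarter R *m (pos (inl i))^T *m s = 0.
  by move=> iS; have := xc0 i iS; rewrite mul_row_col mul1mx.
case Er: (tgt r) => [j|a]; last first.
  have : a \in pin_ends tgt F by rewrite inE; apply/exists_inP; exists r; rewrite ?Er.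
  by rewrite P0 inE.
have jS : j \in inner_ends src tgt F.
  by rewrite inE; apply/exists_inP; exists r; rewrite ?Er ?eqxx ?orbT.
(* Subtracting the conditions at the ends of an edge removes the translation and leaves the rotation
   of a nonzero vector. *)
have s0 : s = 0.
  have : quarter R *m (pos (inl (src r)) - pos (tgt r))^T *m s = 0.
    rewrite linearB /= mulmxBr mulmxBl Er -(addKr t (_ *m s)) (xs _ (src_S r rF)).
    by rewrite addr0 -opprD xs ?oppr0.
  rewrite [s]mx11_scalar mul_mx_scalar => /eqP.
  rewrite scaler_eq0 (negPf (quarter0 _ (pos_neq r))) orbF => /eqP->.
  by rewrite raddf0.
have := xs j jS; rewrite s0 mulmx0 addr0 => ->.
by rewrite col_mx0.
Qed.
End Necessity.

(** * Equivalence of the three conditions *)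

Theorem theorem4 (R : realType) (I P : finType) (G : pinned_graph I P) :
  ((exists pos : I + P -> 'rV[R]_2, isostatic_framework G pos) <->
     pinned_framework_conditions G)
  /\
  (pinned_framework_conditions G <->
     (forall pin : P -> 'rV[R]_2, enough_locations G pin ->
      forall inner : I -> 'rV[R]_2, generic_inner G pin inner ->
        isostatic_framework G (place inner pin))).
Proof.
have [ends endsP] := edge_endpoints G.
have endsE r := (endsP r).1; have ends_neq r := (endsP r).2.
have necessity := isostatic_counts endsE ends_neq.
have sufficiency : pinned_framework_conditions G ->
    forall pin : P -> 'rV[R]_2, enough_locations G pin ->
    forall inner : I -> 'rV[R]_2, generic_inner G pin inner ->
      isostatic_framework G (place inner pin).
  move=> pfc pin locs inner gen.
  have [inner0 full0] := exists_inner endsE ends_neq pfc locs.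
  have cardE : #|edges G| = #|{: I * 'I_2}| by rewrite card_coords pfc.1.
  have free := generic_row_free cardE full0 gen.
  split=> //; first exact: independent_framework endsE ends_neq _ free.
  by rewrite /rigid (eqP free) pfc.1.
(* Distinct pins on the diagonal have enough locations. This placement yields a realization from the
   counts and a test case for the converse from generic positions. *)
pose pin0 (a : P) : 'rV[R]_2 := const_mx (enum_rank a)%:R.
have pin0_inj : injective pin0.
  move=> a b /rowP/(_ 0); rewrite !mxE => /eqP; rewrite eqr_nat => /eqP eq_ab.
  exact/enum_rank_inj/val_inj.
have locs0 : enough_locations G pin0.
  move=> F _ /card_gt1P[a [b [aF bF neq_ab]]] _; exists a, b; split=> //.
  by move/pin0_inj/eqP; apply/negP.
have [inner0 gen0] := exists_generic_inner G pin0.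
split; split.
- by case=> pos; exact: necessity.
- by move=> pfc; exists (place inner0 pin0); apply: sufficiency.
- exact: sufficiency.
- by move=> iso; apply: necessity (iso pin0 locs0 inner0 gen0).
Qed.
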